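(* Let $X$ be a Hausdorff topological space, $Y$ a Polish space, and $b:X\times Y\to\mathbb{R}\cup\{-\infty\}$ a kernel satisfying the standing assumptions of the context. Let $I$ be a set and assume that, for each $i\in I$, $(F_{n,i})_{n\in\mathbb{N}}$ is an asymptotically tight sequence in $\mathcal{QL}(C_b(Y))$ such that $\limsup_{n\to\infty}F_{n,i}(Y)<\infty$ and $\lim_{n\to\infty}\rho(F_{n,i})=0$. Let $g:X\to\overline{\mathbb{R}}$ be defined by $$g(x)=\sup_{i\in I}\limsup_{n\to\infty}F_{n,i}(b(x,\cdot))\quad\text{for all }x\in X,$$ and let $\overline{F}$ be the continuous max-plus linear form with density $B^\circ g$. Assume that all of the following hold: - either $Y$ is discrete, or ($b$ is continuous in the second variable and $B^\circ g(y)>-\infty$ for all $y\in Y$); - either $B^\circ g\in\mathcal{F}_c$, or $b$ is coercive; - $b$ is upper coercive; - $B^\circ g$ is quasi-continuous on its domain. Then: (i) There exists $F\in\mathcal{L}(C_b(Y))$ such that $\sup_{i\in I}\limsup_{n\to\infty}F_{n,i}(G)\ge F(G)$ for all open $G\subset Y$, and $\sup_{i\in I}\limsup_{n\to\infty}F_{n,i}(C)\le F(C)$ for all closed $C\subset Y$. (ii) The l.s.c. density $f$ of this $F$ satisfies $Bf\le g$ on $X$ and $Bf=g$ on $\operatorname{idom}(g)\cup g^{-1}(-\infty)$. Hence $\{(\partial^\circ g)^{-1}(y)\}_{y\in\operatorname{ldom}(B^\circ g)}$ is a covering of $\operatorname{idom}(g)$. (iii) $f\ge B^\circ g$; hence,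 for all closed $C\subset Y$, $\sup_{i\in I}\limsup_{n\to\infty}F_{n,i}(C)\le\overline{F}(C)$. (iv) Let $Z=Z_a\cup\operatorname{int}(Z_t)$, where $Z_a$ (resp. $Z_t$) is the set of algebraically (resp. topologically) essential elements $y\in\operatorname{ldom}(B^\circ g)$ with respect to the covering of $\operatorname{idom}(g)$ in (ii), and $\operatorname{int}(Z_t)$ is the interior of $Z_t$ relative to $\operatorname{dom}(B^\circ g)$. Then $f=B^\circ g$ on $Z$. Hence, for all open $G\subset Y$, $\sup_{i\in I}\limsup_{n\to\infty}F_{n,i}(G)\ge\overline{F}(G\cap Z)$.
   Context: Conventions: $\overline{\mathbb{R}}=\mathbb{R}\cup\{\pm\infty\}$, $-\infty$ is absorbing for addition (so $(-\infty)+(+\infty)=-\infty$), and $a-b$ means $a+(-b)$. $\mathbb{R}_{\max}=\mathbb{R}\cup\{-\infty\}$ (with its usual topology), $\vee$ is the (pointwise) maximum, functions are ordered pointwise, ''l.s.c.'' means lower semicontinuous. Standing assumptions on $b$: $b:X\times Y\to\mathbb{R}\cup\{-\infty\}$ is l.s.c. in the second variable; for every $x\in X$ there is $y\in Y$ with $b(x,y)\in\mathbb{R}$, and for every $y\in Y$ there is $x\in X$ with $b(x,y)\in\mathbb{R}$. Conjugacies and subdifferential: for $f:Y\to\overline{\mathbb{R}}$ l.s.c., $Bf(x)=\sup_{y\in Y}\big(b(x,y)-f(y)\big)$, $x\in X$; for $g:X\to\overline{\mathbb{R}}$, $B^\circ g(y)=\sup_{x\in X}\big(b(x,y)-g(x)\big)$,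 $y\in Y$. For $x\in X$, $\partial^\circ g(x)=\{y\in Y: b(x,y)\in\mathbb{R},\ b(x',y)-g(x')\le b(x,y)-g(x)\ \forall x'\in X\}$, and $(\partial^\circ g)^{-1}(y)=\{x\in X: y\in\partial^\circ g(x)\}$. Domains: for a map $h$ from a topological space $S$ to $\overline{\mathbb{R}}$, $\operatorname{ldom}(h)=\{s:h(s)<+\infty\}$, $\operatorname{dom}(h)=\{s:h(s)\in\mathbb{R}\}$, $\operatorname{idom}(h)=\{s\in\operatorname{dom}(h):\limsup_{s'\to s}h(s')<+\infty\}$. $h$ is quasi-continuous if for every open $G\subset\overline{\mathbb{R}}$, $h^{-1}(G)$ is contained in the closure of its interior; ''quasi-continuous on its domain'' means that the restriction of $h$ to $\operatorname{dom}(h)$ (with the relative topology) is quasi-continuous. Coverings: a family $\{\Phi(z)\}_{z\in Z'}$ of subsets of a set is a covering of $W'$ if $\bigcup_{z\in Z'}\Phi(z)\supset W'$. An element $y\in Z'$ is algebraically essential if $W'\not\subset\bigcup_{z\in Z'\setminus\{y\}}\Phi(z)$; when $Z'$ carries a topology, $y$ is topologically essential if $W'\not\subset\bigcup_{z\in Z'\setminus U}\Phi(z)$ for every open neighbourhood $U$ of $y$ in $Z'$. (Here $Z'=\operatorname{ldom}(B^\circ g)\subset Y$ with the relative topology.) Coercivity: for $x\in X$, $W\subset X$, put $b_{x,W}(y)=\sup_{z\in W}b(z,y)-b(x,y)$. $b$ is coercive if for all $x\in X$ and all neighbourhoods $V$ of $x$, the set $\{y\in Y:b_{x,V}(y)\le\beta\}$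 is relatively compact for all $\beta\in\mathbb{R}$. $b$ is upper coercive if for all $x\in X$ and all neighbourhoods $V$ of $x$ there is a finite $W\subset V$ such that $b(x,\cdot)$ is bounded above on each set $\{y:b_{x,W}(y)\le\beta\}$, $\beta\in\mathbb{R}$. $\mathcal{F}_c$ is the set of l.s.c. $f:Y\to\overline{\mathbb{R}}$ such that for all $x\in X$ and $\beta\in\mathbb{R}$ the set $\{y\in Y:b(x,y)-f(y)\ge\beta\}$ is relatively compact. Function spaces: $(\mathbb{R}_{\max})^Y$ is the set of functions $Y\to\mathbb{R}_{\max}$; $\mathrm{lsc}(Y)$ is the subset of l.s.c. functions; $C_b(Y)$ is the subset of continuous functions bounded above by a real constant. Quasi-linear forms: a map $F:C_b(Y)\to\overline{\mathbb{R}}$ is a quasi-(max-plus-)linear form if it is isotone, additively homogeneous ($F(\lambda+\varphi)=\lambda+F(\varphi)$ for all $\lambda\in\mathbb{R}_{\max}$), and there exists $\alpha\in\mathbb{R}_{\max}$ such that $F(\varphi\vee\psi)\le\alpha+F(\varphi)\vee F(\psi)$ for all $\varphi,\psi$; $\rho(F)$ denotes the infimum of such $\alpha$. It is a max-plus linear form if moreover $\rho(F)\le0$. $F$ is continuous if $F(\varphi_k)\to F(\varphi)$ whenever $\varphi_k\in C_b(Y)$ is nondecreasing in $k$ and converges pointwise to $\varphi\in C_b(Y)$. $\mathcal{QL}(C_b(Y))$ is the set of continuous quasi-linear forms $C_b(Y)\to\mathbb{R}_{\max}$, and $\mathcal{L}(C_b(Y))=\{F\in\mathcal{QL}(C_b(Y)):\rho(F)\le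 0\}$ is the set of continuous max-plus linear forms with values in $\mathbb{R}_{\max}$. A density of $F$ is a map $f:Y\to\overline{\mathbb{R}}$ with $F(\varphi)=\sup_{y\in Y}(\varphi(y)-f(y))$ for all $\varphi\in C_b(Y)$; every element of $\mathcal{L}(C_b(Y))$ has a unique l.s.c. density. Extension: $F\in\mathcal{QL}(C_b(Y))$ is extended to $\mathrm{lsc}(Y)$ by $F(\varphi)=\sup\{F(\psi):\psi\in C_b(Y),\ \psi\le\varphi\}$, then to $(\mathbb{R}_{\max})^Y$ by $F(\varphi)=\inf\{F(\psi):\psi\in\mathrm{lsc}(Y),\ \psi\ge\varphi\}$, with values in $\overline{\mathbb{R}}$. For $A\subset Y$, $F(A):=F(\mathbf{1}_A)$, where $\mathbf{1}_A(y)=0$ if $y\in A$ and $-\infty$ otherwise. For the max-plus linear forms $F$ and $\overline{F}$ with densities $f$ and $B^\circ g$, this means $F(A)=\sup_{y\in A}(-f(y))$ and $\overline{F}(A)=\sup_{y\in A}(-B^\circ g(y))$. A sequence $(F_n)$ in $\mathcal{QL}(C_b(Y))$ is asymptotically tight if $\limsup_n\rho(F_n)<+\infty$ and $\inf_{K\subset Y,\ K\text{ compact}}\limsup_{n\to\infty}F_n(K^c)=-\infty$, with $K^c=Y\setminus K$.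
   Formalization: In (i), F is a continuous max-plus linear form with values in the extended reals, and F is in L(C_b(Y)) whenever sup_i limsup_n F_{n,i}(Y) is finite; the closed bound at C=Y makes this finiteness necessary, and it can fail for infinite I. *)

(* Defs.v *)
From HB Require Import structures.
From mathcomp Require Import all_boot all_order all_algebra.
From mathcomp Require Import all_classical all_reals.
From mathcomp Require Import ereal topology normedtype sequences.

Set Implicit Arguments.
Unset Strict Implicit.
Unset Printing Implicit Defensive.

Import Order.TTheory GRing.Theory Num.Theory.

Local Open Scope classical_set_scope.
Local Open Scope ring_scope.
Local Open Scope ereal_scope.

(* In [\bar R] the sum [-oo + +oo] is [-oo] and [a - b] is [a + (- b)]: these
   are the conventions of the max-plus setting.  The set R_max is rendered as
   the elements of [\bar R] different from [+oo]; its usual topology is the one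
   induced by [\bar R]. *)

Section topological_spaces.

Definition discrete_space (Y : topologicalType) := forall A : set Y, open A.

Definition polish_space (R : realType) (Y : topologicalType) :=
  (exists2 D : set Y, countable D & dense D) /\
  exists d : Y -> Y -> R,
    [/\ (forall y z, (0 <= d y z)%R) /\ (forall y z, d y z = 0%R <-> y = z),
        forall y z, d y z = d z y,
        forall x y z, (d x z <= d x y + d y z)%R,
        forall (y : Y) (A : set Y), nbhs y A <->
          exists2 e : R, (0 < e)%R & [set z | (d y z < e)%R] `<=` A &
        forall u : nat -> Y,
          (forall e : R, (0 < e)%R -> exists N : nat, forall m n : nat,
             (N <= m)%N -> (N <= n)%N -> (d (u m) (u n) < e)%R) ->
          exists l : Y, u @ \oo --> l].

(* [set_type D] carries the relative topology of [D]. *)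
Definition relative_interior (Y : topologicalType) (D A : set Y) : set Y :=
  set_val @` interior (set_val @^-1` A : set (set_type D)).

End topological_spaces.

Section domains.
Context {R : realType} {S : topologicalType}.
Implicit Type h : S -> \bar R.

Definition ldom h : set S := [set s | h s < +oo].

Definition dom h : set S := [set s | h s \is a fin_num].

(* The neighbourhoods of [s] contain [s]; since [h s] is finite, the punctured
   upper limit would give the same set. *)
Definition idom h : set S := [set s | dom h s /\ limf_esup h (nbhs s) < +oo].

Definition quasi_continuous h :=
  forall G : set (\bar R), open G -> h @^-1` G `<=` closure (interior (h @^-1` G)).

End domains.

Definition quasi_continuous_on_domain (R : realType) (S : topologicalType)
    (h : S -> \bar R) :=
  quasi_continuous (fun s : set_type (dom h) => h (set_val s)).

Section coverings.

Definition covering (Z W : Type) (Phi : Z -> set W) (W' : set W) :=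
  W' `<=` \bigcup_z Phi z.

Definition algebraically_essential (Z W : Type) (Phi : Z -> set W)
    (W' : set W) (y : Z) :=
  ~ (W' `<=` \bigcup_(z in [set~ y]) Phi z).

Definition topologically_essential (Z : topologicalType) (W : Type)
    (Phi : Z -> set W) (W' : set W) (y : Z) :=
  forall U : set Z, open U -> U y -> ~ (W' `<=` \bigcup_(z in ~` U) Phi z).

End coverings.

Section kernels.
Context {R : realType} {X Y : topologicalType}.
Variable b : X -> Y -> \bar R.

Definition standing_kernel :=
  [/\ forall x y, b x y < +oo,
      forall x, lower_semicontinuous (b x),
      forall x, exists y, b x y \is a fin_num &
      forall y, exists x, b x y \is a fin_num].

Definition conjugate (f : Y -> \bar R) (x : X) : \bar R :=
  ereal_sup (range (fun y => b x y - f y)).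

Definition dual_conjugate (g : X -> \bar R) (y : Y) : \bar R :=
  ereal_sup (range (fun x => b x y - g x)).

Definition dual_subdiff (g : X -> \bar R) (x : X) : set Y :=
  [set y | b x y \is a fin_num /\
           forall x', b x' y - g x' <= b x y - g x].

Definition dual_subdiff_inv (g : X -> \bar R) (y : Y) : set X :=
  [set x | dual_subdiff g x y].

Definition kernel_gap (x : X) (W : set X) (y : Y) : \bar R :=
  ereal_sup [set b z y | z in W] - b x y.

Definition coercive :=
  forall (x : X) (V : set X), nbhs x V -> forall beta : R,
    precompact [set y | kernel_gap x V y <= beta%:E].

Definition upper_coercive :=
  forall (x : X) (V : set X), nbhs x V ->
    exists W : set X, [/\ finite_set W, W `<=` V &
      forall beta : R, exists M : R, forall y,
        kernel_gap x W y <= beta%:E -> b x y <= M%:E].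

Definition Fc (f : Y -> \bar R) :=
  lower_semicontinuous f /\
  forall (x : X) (beta : R), precompact [set y | beta%:E <= b x y - f y].

End kernels.

Section forms.
Context {R : realType} {Y : topologicalType}.
Implicit Types (phi psi f : Y -> \bar R) (A : set Y).

Definition Cb : set (Y -> \bar R) :=
  [set phi | continuous phi /\ exists M : R, forall y, phi y <= M%:E].

Definition lsc_Rmax : set (Y -> \bar R) :=
  [set phi | lower_semicontinuous phi /\ forall y, phi y < +oo].

(* A form is represented by a total function on [Y -> \bar R] of which only the
   values on [Cb] are ever used. *)
Implicit Type F : (Y -> \bar R) -> \bar R.

Definition isotone F := forall phi psi, Cb phi -> Cb psi ->
  (forall y, phi y <= psi y) -> F phi <= F psi.

Definition additively_homogeneous F :=
  forall (lambda : \bar R) phi, lambda < +oo -> Cb phi ->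
    F (fun y => lambda + phi y) = lambda + F phi.

Definition quasi_max_bounds F : set (\bar R) :=
  [set alpha | alpha < +oo /\ forall phi psi, Cb phi -> Cb psi ->
     F (fun y => maxe (phi y) (psi y)) <= alpha + maxe (F phi) (F psi)].

Definition quasi_linear_form F :=
  [/\ isotone F, additively_homogeneous F & quasi_max_bounds F !=set0].

Definition rho F : \bar R := ereal_inf (quasi_max_bounds F).

Definition linear_form F := quasi_linear_form F /\ rho F <= 0.

Definition continuous_form F :=
  forall (phi_ : nat -> Y -> \bar R) phi, (forall k, Cb (phi_ k)) -> Cb phi ->
    (forall k y, phi_ k y <= phi_ k.+1 y) ->
    (forall y, phi_ k y @[k --> \oo] --> phi y) ->
    F (phi_ k) @[k --> \oo] --> F phi.

Definition QL : set ((Y -> \bar R) -> \bar R) :=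
  [set F | [/\ quasi_linear_form F, continuous_form F &
               forall phi, Cb phi -> F phi < +oo]].

Definition calL : set ((Y -> \bar R) -> \bar R) :=
  [set F | QL F /\ rho F <= 0].

Definition form_of_density f phi : \bar R :=
  ereal_sup (range (fun y => phi y - f y)).

Definition density F f := forall phi, Cb phi -> F phi = form_of_density f phi.

Definition extend_lsc F phi : \bar R :=
  ereal_sup [set F psi | psi in [set psi | Cb psi /\ forall y, psi y <= phi y]].

Definition extend F phi : \bar R :=
  ereal_inf [set extend_lsc F psi |
    psi in [set psi | lsc_Rmax psi /\ forall y, phi y <= psi y]].

Definition maxplus_indic A (y : Y) : \bar R := if y \in A then 0 else -oo.

Definition on_set F A : \bar R := extend F (maxplus_indic A).

Definition asymptotically_tight (F_ : nat -> (Y -> \bar R) -> \bar R) :=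
  limn_esup (fun n => rho (F_ n)) < +oo /\
  ereal_inf [set limn_esup (fun n => on_set (F_ n) (~` K)) |
             K in [set K : set Y | compact K]] = -oo.

End forms.

Definition sup_limsup (R : realType) (I : Type) (u : nat -> I -> \bar R) :
    \bar R :=
  ereal_sup (range (fun i => limn_esup (fun n => u n i))).

(* Main.v *)
Require Import Defs.
From HB Require Import structures.
From mathcomp Require Import all_boot all_order all_algebra.
From mathcomp Require Import all_classical all_reals.
From mathcomp Require Import ereal topology normedtype sequences.
From mathcomp Require Import lra.

Set Implicit Arguments.
Unset Strict Implicit.
Unset Printing Implicit Defensive.

Import Order.TTheory GRing.Theory Num.Theory.

Local Open Scope classical_set_scope.
Local Open Scope ring_scope.
Local Open Scope ereal_scope.

(** Each sequence [F_ n i] enters only through the functional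
    [N i phi = limsup_n extend (F_ n i) phi], and the family only through
    [sup_functional N = sup_i N i], which equals [g x] at [b x] and [L A] at the
    indicator of [A]. The functionals [N i] are defined on all functions; they
    are monotone, homogeneous for real shifts, tight, and stable under binary
    maxima, the last point because the defects [rho (F_ n i)] vanish in the limit
    ([limsup_max_stable]). Extending the defect inequality from continuous to
    arbitrary functions uses the continuity of the forms along increasing
    sequences, together with the fact that on a metric space a lower
    semicontinuous function is an increasing limit of continuous ones.

    The density is the rate function: [- f y] is the infimum of
    [sup_functional N] over the indicators of the open neighbourhoods of [y]. By
    construction [phi y - f y <= sup_functional N phi] for [phi] lower
    semicontinuous ([rate_lower_bound]), and by compactness and tightness
    [sup_functional N phi <= sup_y (phi y - f y)] for [phi] upper semicontinuous
    and bounded above ([rate_upper_bound]). For indicators these are the bounds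
    on open and closed sets. For [b x] the first one is [B f <= g], whence
    [dual_conjugate b g <= f] by the Galois connection. The second one gives
    [g x <= B f x] on [idom g] once upper coercivity has disposed of the region
    where [b x] is large ([sup_functional_le_conjugate]).

    Finally, for [x] in [idom g] the supremum defining [B f x = g x] is attained,
    by coercivity. At a maximizer [y] one has [f y = dual_conjugate b g y] and
    [y] is a subgradient of [g] at [x] ([subdiff_attained]). So the elements of
    the covering at which [f] and [dual_conjugate b g] agree already cover
    [idom g]: an algebraically essential element is one of them, and a
    topologically essential element is a limit of them. In the interior of the
    latter set, quasi-continuity of [dual_conjugate b g] and lower semicontinuity
    of [f] propagate the equality to every point. *)

(** * Extended reals *)

Section extended_reals.
Context {R : realType}.
Implicit Types (x y z : \bar R) (a c : R).

Lemma lte_real_between x y : x < y -> exists r : R, x < r%:E /\ r%:E < y.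
Proof.
case: x => [r| |]; case: y => [s| |] //.
- rewrite lte_fin => rs; exists ((r + s) / 2)%R.
  by rewrite !lte_fin; split; lra.
- by move=> _; exists (r + 1)%R; rewrite lte_fin ltry; split => //; lra.
- by move=> _; exists (s - 1)%R; rewrite lte_fin ltNyr; split => //; lra.
- by move=> _; exists 0%R; rewrite ltry ltNyr.
Qed.

Lemma lee_real_above x y : (forall c, y < c%:E -> x <= c%:E) -> x <= y.
Proof.
move=> h; rewrite leNgt; apply/negP => /lte_real_between[r [yr rx]].
by have := h r yr; rewrite leNgt rx.
Qed.

Lemma lee_real_below x y : (forall c, c%:E < x -> c%:E <= y) -> x <= y.
Proof.
move=> h; rewrite leNgt; apply/negP => /lte_real_between[r [yr rx]].
by have := h r rx; rewrite leNgt yr.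
Qed.

Lemma lte_add_split x y c : x < +oo -> y < +oo -> x + y < c%:E ->
  exists r : R, x < r%:E /\ y < (c - r)%:E.
Proof.
case: x => [x| |] //; case: y => [y| |] // _ _.
- rewrite -EFinD lte_fin => xyc; exists (x + (c - (x + y)) / 2)%R.
  by rewrite !lte_fin; split; lra.
- by move=> _; exists (x + 1)%R; rewrite lte_fin ltNyr; split => //; lra.
- by move=> _; exists (c - (y + 1))%R; rewrite lte_fin ltNyr; split => //; lra.
- by move=> _; exists 0%R; rewrite !ltNyr.
Qed.

Lemma gte_add_split x y c : c%:E < x + y ->
  exists r : R, r%:E < x /\ (c - r)%:E < y.
Proof.
case: x => [x| |] //; case: y => [y| |] //.
- rewrite -EFinD lte_fin => cxy; exists (x - (x + y - c) / 2)%R.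
  by rewrite !lte_fin; split; lra.
- by move=> _; exists (x - 1)%R; rewrite lte_fin ltry; split => //; lra.
- by move=> _; exists (c - (y - 1))%R; rewrite lte_fin ltry; split => //; lra.
- by move=> _; exists 0%R; rewrite !ltry.
Qed.

(** The Galois connection underlying the conjugacies, valid with [-oo]
    absorbing. *)
Lemma lee_subl_swap x y z : x - y <= z -> x - z <= y.
Proof.
case: x => [x| |]; case: y => [y| |]; case: z => [z| |] //=;
  rewrite ?leey ?leNye //.
by rewrite -!EFinB !lee_fin; lra.
Qed.

Lemma lee_real_addl a x y : a%:E + x <= y -> x <= (- a)%:E + y.
Proof.
case: x => [x| |]; case: y => [y| |] //=; rewrite ?leey ?leNye //.
by rewrite -!EFinD !lee_fin; lra.
Qed.

Lemma adde_realK a x : (- a)%:E + (a%:E + x) = x.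
Proof. by rewrite addeA -EFinD addNr add0e. Qed.

Lemma lte_real_addl a x c : (a%:E + x < c%:E) = (x < (c - a)%:E).
Proof.
case: x => [x| |] //=; last by rewrite !ltNyr.
by rewrite -EFinD !lte_fin; apply/idP/idP => ?; lra.
Qed.

Lemma lee_sup_range (T : Type) (u : T -> \bar R) t : u t <= ereal_sup (range u).
Proof. by apply: ereal_sup_ubound; exists t. Qed.

Lemma ge_sup_range (T : Type) (u : T -> \bar R) x :
  (forall t, u t <= x) -> ereal_sup (range u) <= x.
Proof. by move=> h; apply: ge_ereal_sup => _ [t _ <-]. Qed.

End extended_reals.

Section upper_limits.
Context {R : realType}.

Lemma limf_esup_lt (T : topologicalType) (u : T -> \bar R) (F : set_system T)
    {FF : Filter F} x :
  limf_esup u F < x -> \forall t \near F, u t < x.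
Proof.
move=> /ereal_inf_lt[_ [V FV <-]] Vx.
apply: filterS FV => t Vt; apply: le_lt_trans Vx.
by apply: ereal_sup_ubound; exists t.
Qed.

Lemma limn_esup_lt (u : nat -> \bar R) x :
  limn_esup u < x -> \forall n \near \oo, u n < x.
Proof. by move=> /(@limf_esup_lt nat u \oo eventually_filter). Qed.

Lemma limf_esup_ge_near (T : topologicalType) (u : T -> \bar R)
    (F : set_system T) x :
  (\forall t \near F, u t <= x) -> limf_esup u F <= x.
Proof.
move=> h; apply: ereal_inf_le; exists (ereal_sup (u @` [set t | u t <= x])).
  by exists [set t | u t <= x].
by apply: ge_ereal_sup => _ [t ut <-].
Qed.

End upper_limits.

(** * Approximation of lower semicontinuous functions from below *)

Section approximation.
Context {R : realType} {Y : topologicalType}.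
Implicit Types (phi psi : Y -> \bar R).

(** The property of [Y] through which its metric acts on the extension of
    forms: countable monotone approximation is what continuity along sequences
    of a form can be applied to. *)
Definition Cb_approximable :=
  forall phi, lsc_Rmax phi -> exists phi_ : nat -> Y -> \bar R,
    [/\ forall k, Cb (phi_ k),
        forall k y, phi_ k y <= phi_ k.+1 y,
        forall k y, phi_ k y <= phi y &
        forall y (c : R), c%:E < phi y -> exists k, c%:E < phi_ k y].

Section lipschitz_regularization.
Variable d : Y -> Y -> R.
Hypothesis d_ge0 : forall y z, (0 <= d y z)%R.
Hypothesis d_refl : forall y, d y y = 0%R.
Hypothesis d_sym : forall y z, d y z = d z y.
Hypothesis d_triangle : forall x y z, (d x z <= d x y + d y z)%R.
Hypothesis d_nbhs : forall (y : Y) (A : set Y), nbhs y A <->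
  exists2 e : R, (0 < e)%R & [set z | (d y z < e)%R] `<=` A.
Variable phi : Y -> \bar R.
Hypothesis phi_lsc : lower_semicontinuous phi.

(** [contract] makes the values bounded, so that the infimal convolution with
    the [k]-Lipschitz cone is real-valued even where [phi] is [-oo]; truncating
    at [k] first keeps the approximants bounded above by a real. *)
Let cone k y z : R := (contract (mine (phi z) k%:R%:E) + k%:R * d y z)%R.
Let reg k y : R := inf (range (cone k y)).

Let cone_geN1 k y z : (-1 <= cone k y z)%R.
Proof.
have := contract_le1 (mine (phi z) k%:R%:E); rewrite ler_norml => /andP[h _].
rewrite /cone; apply: le_trans h _.
by rewrite lerDl mulr_ge0.
Qed.

Let reg_le k y z : (reg k y <= cone k y z)%R.
Proof.
apply: ge_inf; last by exists z.
by exists (-1)%R => _ [t _ <-].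
Qed.

Let le_reg k y (m : R) : (forall z, m <= cone k y z)%R -> (m <= reg k y)%R.
Proof.
by move=> h; apply: lb_le_inf; [exists (cone k y y), y | move=> _ [z _ <-]].
Qed.

Let reg_contract k y : (reg k y <= contract (mine (phi y) k%:R%:E))%R.
Proof. by apply: le_trans (reg_le k y y) _; rewrite /cone d_refl mulr0 addr0. Qed.

Let reg_norm k y : (`|reg k y| <= 1)%R.
Proof.
rewrite ler_norml le_reg //=; apply: le_trans (reg_contract k y) _.
by have := contract_le1 (mine (phi y) k%:R%:E); rewrite ler_norml => /andP[].
Qed.

Let reg_lipschitz k y z : (reg k y <= reg k z + k%:R * d y z)%R.
Proof.
rewrite -lerBlDr; apply: le_reg => t; rewrite lerBlDr.
apply: le_trans (reg_le k y t) _; rewrite /cone -addrA lerD2l -mulrDr.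
by rewrite ler_wpM2l // addrC d_triangle.
Qed.

Let reg_mono k y : (reg k y <= reg k.+1 y)%R.
Proof.
apply: le_reg => z; apply: le_trans (reg_le k y z) _.
rewrite /cone lerD //; last by rewrite ler_wpM2r // ler_nat.
rewrite le_contract le_min !ge_min lexx /=.
by apply/orP; right; rewrite lee_fin ler_nat.
Qed.

Let reg_cvg y (c : R) : c%:E < phi y ->
  exists k, (contract c%:E < reg k y)%R.
Proof.
move=> /lte_real_between[c' [cc' c'phi]].
have [V yV Vphi] := phi_lsc c'phi.
have [r r0 rV] := (d_nbhs y V).1 yV.
pose k := maxn (Num.truncn `|c'|).+1 (Num.truncn (2 / r)%R).+1.
have kc : (c' <= k%:R)%R.
  apply: le_trans (ler_norm c') _; apply: le_trans (ltW (truncnS_gt _)) _.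
  by rewrite ler_nat leq_maxl.
have kr : (2 <= k%:R * r)%R.
  rewrite -ler_pdivrMr //; apply: le_trans (ltW (truncnS_gt _)) _.
  by rewrite ler_nat leq_maxr.
exists k; apply: (@lt_le_trans _ _ (contract c'%:E)); first by rewrite lt_contract.
apply: le_reg => z; have [zr|zr] := ltP (d y z) r.
  rewrite /cone; apply: (@le_trans _ _ (contract (mine (phi z) k%:R%:E))).
    by rewrite le_contract le_min lee_fin kc andbT ltW // Vphi //; exact: rV.
  by rewrite lerDl mulr_ge0.
have := contract_le1 (mine (phi z) k%:R%:E).
have := contract_le1 c'%:E; rewrite !ler_norml => /andP[_ c1] /andP[m1 _].
have : (2 <= k%:R * d y z)%R by apply: le_trans kr _; rewrite ler_wpM2l.
by rewrite /cone; lra.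
Qed.

Let expand_reg_continuous k : continuous (fun y => expand (reg k y)).
Proof.
have reg_in t : reg k t \in [pred r | (`|r| <= 1)%R] by rewrite inE reg_norm.
move=> y; apply/cvg_ballP => e e0.
change (nbhs y [set z | ball (expand (reg k y)) e (expand (reg k z))]).
apply/d_nbhs; exists (e / k.+1%:R)%R; first by rewrite divr_gt0.
move=> z /= yz; change (`|contract (expand (reg k y)) -
  contract (expand (reg k z))| < e)%R.
rewrite !expandK //; have := reg_lipschitz k y z; have := reg_lipschitz k z y.
have : (k%:R * d y z < e)%R.
  apply: (@le_lt_trans _ _ (k.+1%:R * d y z)%R).
    by rewrite ler_wpM2r // ler_nat.
  by rewrite mulrC -ltr_pdivlMr.
by rewrite (d_sym z y) ltr_norml; lra.
Qed.

Lemma lipschitz_regularization : exists phi_ : nat -> Y -> \bar R,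
  [/\ forall k, Cb (phi_ k),
      forall k y, phi_ k y <= phi_ k.+1 y,
      forall k y, phi_ k y <= phi y &
      forall y (c : R), c%:E < phi y -> exists k, c%:E < phi_ k y].
Proof.
have reg_in k t : reg k t \in [pred r | (`|r| <= 1)%R] by rewrite inE reg_norm.
have reg_min k y : expand (reg k y) <= mine (phi y) k%:R%:E.
  by rewrite le_expandLR ?inE.
exists (fun k y => expand (reg k y)); split => //.
- move=> k; split; first exact: expand_reg_continuous.
  by exists k%:R => y; apply: le_trans (reg_min k y) _; rewrite ge_min lexx orbT.
- by move=> k y; apply/le_expand/reg_mono.
- by move=> k y; apply: le_trans (reg_min k y) _; rewrite ge_min lexx.
- by move=> y c /reg_cvg[k ck]; exists k; rewrite lt_expandRL ?inE.
Qed.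

End lipschitz_regularization.

Lemma polish_Cb_approximable : polish_space R Y -> Cb_approximable.
Proof.
move=> [_ [d [[d0 dE] ds dt dn _]]] phi [phi_lsc _].
by apply: (@lipschitz_regularization d) => // y; apply/dE.
Qed.

End approximation.

(** * The extension of a quasi-linear form *)

Section extension.
Context {R : realType} {Y : topologicalType}.
Implicit Types (phi psi chi : Y -> \bar R) (F : (Y -> \bar R) -> \bar R).

Lemma Cb_max phi psi : Cb phi -> Cb psi -> Cb (fun y => maxe (phi y) (psi y)).
Proof.
move=> [cphi [M Mphi]] [cpsi [N Npsi]]; split.
  exact: (max_fun_continuous cphi cpsi).
exists (Num.max M N) => y; rewrite ge_max EFin_max !le_max.
by rewrite Mphi Npsi orbT.
Qed.

Lemma Cb_min phi psi : Cb phi -> Cb psi -> Cb (fun y => mine (phi y) (psi y)).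
Proof.
move=> [cphi [M Mphi]] [cpsi _]; split.
  exact: (min_fun_continuous cphi cpsi).
by exists M => y; rewrite ge_min Mphi.
Qed.

Lemma Cb_shift (a : R) phi : Cb phi -> Cb (fun y => a%:E + phi y).
Proof.
move=> [cphi [M Mphi]]; split; last first.
  by exists (a + M)%R => y; rewrite EFinD leeD2l.
by move=> y; apply: cvgeD => //; [exact: cvg_cst | exact: cphi].
Qed.

Lemma lsc_Rmax_max phi psi : lsc_Rmax phi -> lsc_Rmax psi ->
  lsc_Rmax (fun y => maxe (phi y) (psi y)).
Proof.
move=> [lphi phi_oo] [lpsi psi_oo]; split=> [y a|y]; last first.
  by rewrite gt_max phi_oo psi_oo.
rewrite lt_max => /orP[/lphi|/lpsi] [V yV aV]; exists V => // z /aV az.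
  by rewrite lt_max az.
by rewrite lt_max az orbT.
Qed.

Lemma lsc_Rmax_shift (a : R) phi : lsc_Rmax phi ->
  lsc_Rmax (fun y => a%:E + phi y).
Proof.
move=> [lphi phi_oo]; split=> [y c|y]; last by rewrite lte_add_pinfty // ltry.
have shiftE t : (c%:E < a%:E + phi t) = ((c - a)%:E < phi t).
  case: (phi t) => [r| |] //=; last by rewrite !ltry.
  by rewrite -EFinD !lte_fin; apply/idP/idP => ?; lra.
by rewrite shiftE => /lphi[V yV cV]; exists V => // z; rewrite shiftE; exact: cV.
Qed.

Lemma extend_isotone F phi psi : (forall y, phi y <= psi y) ->
  extend F phi <= extend F psi.
Proof.
move=> h; apply: le_ereal_inf => _ [chi [lchi psichi] <-].
by exists chi => //; split => // y; exact: le_trans (h y) (psichi y).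
Qed.

Lemma extend_lsc_shift F (a : R) phi : additively_homogeneous F ->
  extend_lsc F (fun y => a%:E + phi y) <= a%:E + extend_lsc F phi.
Proof.
move=> hF; apply: ge_ereal_sup => _ [chi [Cchi chile] <-].
have -> : chi = (fun y => a%:E + ((- a)%:E + chi y)).
  by apply/funext => y; rewrite -{1}[a]opprK adde_realK.
rewrite hF ?ltry //; last exact: Cb_shift.
apply: leeD2l; apply: ereal_sup_ubound; exists (fun y => (- a)%:E + chi y) => //.
split; [exact: Cb_shift | move=> y].
by rewrite -[leRHS](adde_realK a); apply: leeD2l.
Qed.

Lemma extend_shift F (a : R) phi : additively_homogeneous F ->
  extend F (fun y => a%:E + phi y) <= a%:E + extend F phi.
Proof.
move=> hF; apply: lee_real_above => c; rewrite lte_real_addl.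
move=> /ereal_inf_lt[_ [psi [lpsi phipsi] <-]] psic.
apply: (@le_trans _ _ (extend_lsc F (fun y => a%:E + psi y))).
  apply: ereal_inf_lbound; exists (fun y => a%:E + psi y) => //.
  by split; [exact: lsc_Rmax_shift | move=> y; apply: leeD2l].
apply: le_trans (extend_lsc_shift _ _ hF) _.
by rewrite ltW // lte_real_addl.
Qed.

(** A minorant [chi] of [phi \max psi] need not be a maximum of minorants in
    [Cb], but it is the increasing limit of such functions cut off at [chi];
    this is where the continuity of [F] enters. *)
Lemma extend_lsc_max F (alpha : \bar R) phi psi :
  Cb_approximable (R := R) (Y := Y) -> isotone F -> continuous_form F ->
  quasi_max_bounds F alpha -> lsc_Rmax phi -> lsc_Rmax psi ->
  extend_lsc F (fun y => maxe (phi y) (psi y)) <=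
    alpha + maxe (extend_lsc F phi) (extend_lsc F psi).
Proof.
move=> apx isoF contF [_ alphaF] lphi lpsi.
have [phi_ [Cphi mphi phi_le phi_cvg]] := apx _ lphi.
have [psi_ [Cpsi mpsi psi_le psi_cvg]] := apx _ lpsi.
apply: ge_ereal_sup => _ [chi [Cchi chile] <-].
pose chi_ k y := mine (chi y) (maxe (phi_ k y) (psi_ k y)).
have Cmax k : Cb (fun y => maxe (phi_ k y) (psi_ k y)) by exact: Cb_max.
have Cchi_ k : Cb (chi_ k) by exact: Cb_min.
have mchi k y : chi_ k y <= chi_ k.+1 y.
  rewrite /chi_ le_min ge_min lexx /= ge_min; apply/orP; right.
  by rewrite ge_max !le_max mphi mpsi orbT.
have chi_chi k y : chi_ k y <= chi y by rewrite /chi_ ge_min lexx.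
have mchi' y : {homo chi_ ^~ y : m n / (m <= n)%N >-> m <= n}.
  exact: homo_leq (fun x => lexx x) (fun x y z => @le_trans _ _ x y z)
    (fun k => mchi k y).
have chi_cvg y : chi_ k y @[k --> \oo] --> chi y.
  have := ereal_nondecreasing_cvgn (mchi' y).
  suff -> : ereal_sup (range (chi_ ^~ y)) = chi y by [].
  apply/eqP; rewrite eq_le ge_sup_range //=; apply: lee_real_below => c cchi.
  have [k ck] : exists k, c%:E < maxe (phi_ k y) (psi_ k y).
    have := lt_le_trans cchi (chile y).
    rewrite lt_max => /orP[/phi_cvg|/psi_cvg] [k ck]; exists k.
      by rewrite lt_max ck.
    by rewrite lt_max ck orbT.
  apply: le_trans (lee_sup_range _ k).
  by rewrite /chi_ le_min !ltW.
have Fcvg := contF _ _ Cchi_ Cchi mchi chi_cvg.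
have chi_bound k : F (chi_ k) <= alpha + maxe (extend_lsc F phi) (extend_lsc F psi).
  apply: (@le_trans _ _ (F (fun y => maxe (phi_ k y) (psi_ k y)))).
    by apply: isoF => // y; rewrite /chi_ ge_min lexx orbT.
  apply: le_trans (alphaF _ _ (Cphi k) (Cpsi k)) _; apply: leeD2l.
  rewrite ge_max !le_max; apply/andP; split; apply/orP; [left|right];
    apply: ereal_sup_ubound; [exists (phi_ k) | exists (psi_ k)] => //.
rewrite -(cvg_lim _ Fcvg) //; apply: lime_le.
  by apply/cvg_ex; exists (F chi).
by near=> k; exact: chi_bound.
Unshelve. all: by end_near. Qed.

Lemma extend_max F (alpha c : R) phi psi :
  Cb_approximable (R := R) (Y := Y) -> isotone F -> continuous_form F ->
  rho F < alpha%:E -> extend F phi < c%:E -> extend F psi < c%:E ->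
  extend F (fun y => maxe (phi y) (psi y)) <= (alpha + c)%:E.
Proof.
move=> apx isoF contF /ereal_inf_lt[beta beta_bd beta_alpha].
move=> /ereal_inf_lt[_ [phi' [lphi' phi'le] <-] phi'c].
move=> /ereal_inf_lt[_ [psi' [lpsi' psi'le] <-] psi'c].
apply: (@le_trans _ _ (extend_lsc F (fun y => maxe (phi' y) (psi' y)))).
  apply: ereal_inf_lbound; exists (fun y => maxe (phi' y) (psi' y)) => //.
  split; first exact: lsc_Rmax_max.
  by move=> y; rewrite ge_max !le_max phi'le psi'le orbT.
apply: le_trans (extend_lsc_max apx isoF contF beta_bd lphi' lpsi') _.
rewrite EFinD; apply: leeD; first exact: ltW.
by rewrite ge_max !ltW.
Qed.

End extension.

(** * Limits of quasi-linear forms as max-plus sublinear functionals *)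

Section sublinear.
Context {R : realType} {Y : topologicalType}.
Implicit Types (phi psi : Y -> \bar R) (A B U : set Y)
  (N : (Y -> \bar R) -> \bar R).

(** Unlike a form, such an [N] acts on all functions. One inequality in the
    second clause is enough, since applying it to [- a] gives the other. *)
Definition maxplus_monotone N :=
  (forall phi psi, (forall y, phi y <= psi y) -> N phi <= N psi) /\
  (forall (a : R) phi, N (fun y => a%:E + phi y) <= a%:E + N phi).

Definition max_stable N := forall phi psi (c : R), N phi <= c%:E ->
  N psi <= c%:E -> N (fun y => maxe (phi y) (psi y)) <= c%:E.

Definition tight N := forall c : R,
  exists2 K : set Y, compact K & N (maxplus_indic (~` K)) < c%:E.

Section limit.
Variable F_ : nat -> (Y -> \bar R) -> \bar R.
Hypothesis QL_F : forall n, QL (F_ n).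
Let N phi := limn_esup (fun n => extend (F_ n) phi).

Lemma limsup_monotone : maxplus_monotone N.
Proof.
split=> [phi psi h|a phi]; apply: lee_real_above => c.
  move=> /limn_esup_lt Nc; apply: limf_esup_ge_near.
  by apply: filterS Nc => n /ltW; apply: le_trans; exact: extend_isotone.
rewrite lte_real_addl => /limn_esup_lt Nc; apply: limf_esup_ge_near.
apply: filterS Nc => n; rewrite -lte_real_addl => /ltW; apply: le_trans.
by apply: extend_shift; have [[]] := QL_F n.
Qed.

Lemma limsup_max_stable : Cb_approximable (R := R) (Y := Y) ->
  rho (F_ n) @[n --> \oo] --> (0 : \bar R) -> max_stable N.
Proof.
move=> apx rho0 phi psi c phic psic; apply: lee_real_above => c'.
move=> /lte_real_between[m [cm]]; rewrite lte_fin -subr_gt0 => e0.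
have rho_e : \forall n \near \oo, rho (F_ n) < (c' - m)%:E.
  have /rho0 // : nbhs (0 : \bar R) [set x | x < (c' - m)%:E].
  by apply: open_ereal_lt'; rewrite lte_fin.
apply: limf_esup_ge_near.
have phi_near := limn_esup_lt (le_lt_trans phic cm).
have psi_near := limn_esup_lt (le_lt_trans psic cm).
apply: filterS3 phi_near psi_near rho_e => n phin psin rhon.
have [[isoF _ _] contF _] := QL_F n.
by have := extend_max apx isoF contF rhon phin psin; rewrite subrK.
Qed.

Lemma limsup_tight : asymptotically_tight F_ -> tight N.
Proof.
move=> [_ infE] c.
have /ereal_inf_lt[_ [K cK <-] Kc] : ereal_inf [set limn_esup (fun n =>
    on_set (F_ n) (~` K)) | K in [set K : set Y | compact K]] < c%:E.
  by rewrite infE ltNyr.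
by exists K.
Qed.

End limit.

End sublinear.

(** * Upper and lower bounds by the rate function *)

(** Compactness in the form used for large deviation upper bounds: a property
    inherited by subsets and finite unions holds on a compact set once it holds
    near every point. *)
Lemma compact_ideal (T : topologicalType) (J : set (set T)) (K : set T) :
  J set0 -> (forall A B, A `<=` B -> J B -> J A) ->
  (forall A B, J A -> J B -> J (A `|` B)) ->
  (forall y : T, exists2 U, nbhs y U & J U) -> compact K -> J K.
Proof.
move=> J0 Jsub JU Jloc cK; apply: contrapT => nJK.
pose G : set_system T := [set A | J (K `\` A)].
have FG : ProperFilter G.
  split; first by rewrite /G /= setD0.
  split=> [|A B|A B AB]; rewrite /G /=.
  - by rewrite setDT.
  - by rewrite setDIr; exact: JU.
  - by apply: Jsub; exact: setDS.
have GK : G K by rewrite /G /= setDv.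
have [y [_ Gy]] := cK G FG GK.
have [U yU JUU] := Jloc y.
have GU : G (~` U) by apply: Jsub JUU; rewrite setDE setCK; exact: subIsetr.
by have [z []] := Gy _ _ GU yU.
Qed.

Section semicontinuity.
Context {R : realType} {Y : topologicalType}.
Implicit Types (phi psi f : Y -> \bar R).

Definition usc phi := forall y (a : R), phi y < a%:E ->
  \forall z \near y, phi z < a%:E.

Lemma discrete_usc phi : discrete_space Y -> usc phi.
Proof.
move=> dY y a ya; have : nbhs y [set y].
  by apply: open_nbhs_nbhs; split.
by apply: filterS => _ ->.
Qed.

Lemma continuous_usc phi : continuous phi -> usc phi.
Proof. by move=> cphi y a ya; apply: (cphi y [set x | x < a%:E]); exact: open_ereal_lt'. Qed.

Lemma usc_sub phi f : usc phi -> lower_semicontinuous f ->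
  (forall y, phi y < +oo) -> (forall y, -oo < f y) ->
  usc (fun y => phi y - f y).
Proof.
move=> uphi lf phi_oo f_oo y a.
have Nf_oo t : - f t < +oo by rewrite lteNl.
move=> /(lte_add_split (phi_oo y) (Nf_oo y))[r [yr]].
rewrite lteNl => /lf[V yV fV].
apply: filterS2 (uphi _ _ yr) yV => z zr /fV; rewrite EFinN lteNl => fz.
case: (phi z) (f z) zr fz => [u| |] [v| |] //; rewrite ?ltNyr //.
by rewrite -EFinN -EFinD !lte_fin; lra.
Qed.

(** An upper semicontinuous function attains its supremum [s] when its upper
    level sets are relatively compact: otherwise it would stay below some real
    [r < s] near every point, hence on a compact set containing an upper level
    set. *)
Lemma usc_attains_sup (h : Y -> \bar R) (s : R) : usc h ->
  (forall y, h y <= s%:E) ->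
  (forall r : R, (r < s)%R -> exists y, r%:E < h y) ->
  (forall r : R, precompact [set y | r%:E <= h y]) ->
  exists y, h y = s%:E.
Proof.
move=> uh hs hsup hpre; apply: contrapT => nattained.
have [K sK [cK _]] := hpre (s - 1)%R.
pose J A := exists2 r : R, (r < s)%R & forall y, A y -> h y <= r%:E.
have [] : J K.
  apply: compact_ideal cK.
  - by exists (s - 1)%R => //; lra.
  - by move=> A B AB [r rs Br]; exists r => // y /AB/Br.
  - move=> A B [r rs Ar] [t ts Bt]; exists (Num.max r t).
      by rewrite gt_max rs ts.
    by move=> y [/Ar|/Bt] hy; rewrite EFin_max le_max hy ?orbT.
  - move=> y; have : h y < s%:E.
      by rewrite lt_neqAle hs andbT; apply/eqP => hys; apply: nattained; exists y.
    move=> /lte_real_between[r [hr rs]].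
    exists [set z | h z < r%:E]; first exact: uh.
    by exists r; [rewrite -lte_fin | move=> z /ltW].
move=> r rs Kr.
have [y] := hsup (Num.max r (s - 1)%R) ltac:(by rewrite gt_max rs /=; lra).
rewrite EFin_max gt_max => /andP[ry sy].
have : h y <= r%:E by apply: Kr; apply: sK; exact: ltW.
by rewrite leNgt ry.
Qed.

End semicontinuity.

Section rate_function.
Context {R : realType} {Y : topologicalType}.
Implicit Types (phi psi : Y -> \bar R) (A U : set Y)
  (N : (Y -> \bar R) -> \bar R).

(** The upper rate function of large deviation theory, with [N] restricted to
    indicators in the role of the limiting logarithmic probabilities. *)
Definition rate N (y : Y) : \bar R :=
  - ereal_inf [set N (maxplus_indic U) | U in [set U : set Y | open U /\ U y]].

Definition cut A phi (y : Y) : \bar R := if y \in A then phi y else -oo.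

Lemma cut_in A phi y : A y -> cut A phi y = phi y.
Proof. by move=> Ay; rewrite /cut mem_set. Qed.

Lemma cut_out A phi y : ~ A y -> cut A phi y = -oo.
Proof. by move=> nAy; rewrite /cut memNset. Qed.

Lemma cut_le A phi psi : (forall y, A y -> phi y <= psi y) ->
  forall y, cut A phi y <= psi y.
Proof.
move=> h y; have [Ay|nAy] := pselect (A y); first by rewrite cut_in //; exact: h.
by rewrite cut_out // leNye.
Qed.

Lemma indic_in A y : A y -> maxplus_indic A y = 0 :> \bar R.
Proof. by move=> Ay; rewrite /maxplus_indic mem_set. Qed.

Lemma indic_out A y : ~ A y -> maxplus_indic A y = -oo :> \bar R.
Proof. by move=> nAy; rewrite /maxplus_indic memNset. Qed.

Lemma indic_le A psi : (forall y, A y -> 0 <= psi y) ->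
  forall y, maxplus_indic A y <= psi y.
Proof. exact: (@cut_le A (fun=> 0)). Qed.

Lemma indic_usc A : closed A -> usc (maxplus_indic A : Y -> \bar R).
Proof.
move=> cA y a; have [Ay|nAy] := pselect (A y).
  rewrite indic_in // => a0; apply: filterE => z.
  by apply: le_lt_trans a0; exact: indic_le.
move=> _; have : nbhs y (~` A).
  by apply: open_nbhs_nbhs; split => //; exact: closed_openC.
by apply: filterS => z nAz; rewrite indic_out // ltNyr.
Qed.

Lemma rate_lsc N : lower_semicontinuous (rate N).
Proof.
move=> y a; rewrite lteNr => /ereal_inf_lt[_ [U [oU Uy] <-] Ua].
exists U; first exact: open_nbhs_nbhs.
move=> z Uz; rewrite lteNr; apply: le_lt_trans Ua.
by apply: ereal_inf_lbound; exists U.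
Qed.

Lemma rate_antitone N N' : (forall phi, N phi <= N' phi) ->
  forall y, rate N' y <= rate N y.
Proof.
move=> h y; rewrite leeN2; apply: lee_real_above => c.
move=> /ereal_inf_lt[_ [U UU <-] Uc]; apply: le_trans (ltW Uc).
by apply: le_trans (h _); apply: ereal_inf_lbound; exists U.
Qed.

(** For real [a < phi y] the set [{a < phi}] is an open neighbourhood of [y] on
    which [phi] dominates [a], so [a - rate N y <= N phi]. *)
Lemma rate_lower_bound N phi y : maxplus_monotone N ->
  lower_semicontinuous phi -> phi y - rate N y <= N phi.
Proof.
move=> [Nmono Nshift] lphi; apply: lee_real_below => c.
rewrite /rate oppeK => /gte_add_split[a [ay ca]].
pose U := [set z | a%:E < phi z].
have oU : open U by exact: (lower_semicontinuousP phi).1.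
have caU : (c - a)%:E < N (maxplus_indic U).
  by apply: lt_le_trans ca _; apply: ereal_inf_lbound; exists U.
have : N (maxplus_indic U) <= (- a)%:E + N phi.
  apply: le_trans (Nshift _ _); apply: Nmono; apply: indic_le => z Uz.
  have -> : 0 = (- a)%:E + a%:E :> \bar R by rewrite -EFinD addNr.
  by apply: leeD2l; exact: ltW.
move=> /(lt_le_trans caU) /ltW; rewrite EFinB addeC => ha.
have := leeD2l a%:E ha; rewrite addeA subee // add0e.
by rewrite addeA -EFinD subrr add0e.
Qed.

(** The Laplace-Varadhan upper bound. A neighbourhood [U] of [y] on which
    [phi < r] contributes at most [r + N (maxplus_indic U)], which is close to
    [phi y - rate N y]; compactness collects finitely many of these, and what
    lies outside the compact set is negligible by tightness. *)
Lemma rate_upper_bound N phi (M : R) : maxplus_monotone N -> max_stable N ->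
  tight N -> N (maxplus_indic [set: Y]) < +oo -> usc phi ->
  (forall y, phi y <= M%:E) -> N phi <= form_of_density (rate N) phi.
Proof.
move=> [Nmono Nshift] Nmax Ntight NY uphi phiM; apply: lee_real_above => c phic.
have [K cK Kc] := Ntight (c - M)%R.
have tail_c : N (fun y => M%:E + maxplus_indic (~` K) y) <= c%:E.
  apply: le_trans (Nshift _ _) _; apply: ltW.
  by rewrite lte_real_addl.
have core_c : N (cut K phi) <= c%:E.
  pose J A := N (cut A phi) <= c%:E; rewrite -/(J K).
  apply: (@compact_ideal _ J K) cK.
  - apply: le_trans tail_c; apply: Nmono; exact: cut_le.
  - move=> A B AB; apply: le_trans; apply: Nmono; apply: cut_le => y Ay.
    by rewrite cut_in //; exact: AB.
  - move=> A B JA JB; apply: le_trans (Nmax _ _ _ JA JB); apply: Nmono.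
    apply: cut_le => y [Ay|By]; rewrite le_max.
      by rewrite (cut_in _ Ay) lexx.
    by rewrite (cut_in _ By) lexx orbT.
  - move=> y; have yc : phi y - rate N y < c%:E.
      exact: le_lt_trans (lee_sup_range _ y) phic.
    have rate_y : - rate N y < +oo.
      rewrite oppeK; apply: le_lt_trans NY; apply: ereal_inf_lbound.
      by exists [set: Y] => //; split => //; exact: openT.
    have phi_y : phi y < +oo by apply: le_lt_trans (phiM y) (ltry _).
    have [r [yr]] := lte_add_split phi_y rate_y yc.
    rewrite oppeK => /ereal_inf_lt[_ [U [oU Uy] <-] Ur].
    exists (U `&` [set z | phi z < r%:E]).
      by apply: filterI; [exact: open_nbhs_nbhs | exact: uphi].
    apply: le_trans (Nmono _ (fun z => r%:E + maxplus_indic U z) _) _.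
      apply: cut_le => z [Uz /ltW zr].
      by rewrite indic_in // adde0.
    apply: le_trans (Nshift _ _) _; apply: ltW.
    by rewrite lte_real_addl.
apply: le_trans (Nmax _ _ _ core_c tail_c); apply: Nmono => y; rewrite le_max.
have [Ky|nKy] := pselect (K y); first by rewrite cut_in ?lexx.
by rewrite (indic_in (A := ~` K)) // adde0 phiM orbT.
Qed.

End rate_function.

(** * Max-plus linear forms with a lower semicontinuous density *)

Section densities.
Context {R : realType} {Y : topologicalType}.
Implicit Types (phi psi f : Y -> \bar R) (A U : set Y).

Lemma form_of_density_mono f phi psi : (forall y, phi y <= psi y) ->
  form_of_density f phi <= form_of_density f psi.
Proof.
move=> h; apply: ge_sup_range => y; apply: le_trans (lee_sup_range _ y).
exact: leeD2r.
Qed.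

Lemma form_of_density_antitone f f' phi : (forall y, f' y <= f y) ->
  form_of_density f phi <= form_of_density f' phi.
Proof.
move=> h; apply: ge_sup_range => y; apply: le_trans (lee_sup_range _ y).
by apply: leeD2l; rewrite leeN2.
Qed.

Lemma form_of_density_max f phi psi :
  form_of_density f (fun y => maxe (phi y) (psi y)) <=
    maxe (form_of_density f phi) (form_of_density f psi).
Proof.
apply: ge_sup_range => y; rewrite le_max.
have [_|_] := leP (phi y) (psi y); apply/orP; [right|left];
  exact: lee_sup_range.
Qed.

Lemma form_of_density_homogeneous f : additively_homogeneous (form_of_density f).
Proof.
move=> [a| |] // phi _ _; last first.
  by apply/eqP; rewrite eq_le leNye andbT; apply: ge_sup_range => y.
apply/eqP; rewrite eq_le; apply/andP; split.
  apply: ge_sup_range => y; rewrite -addeA; apply: leeD2l.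
  exact: lee_sup_range.
rewrite -[leRHS](adde_realK (- a)) opprK; apply: leeD2l.
apply: ge_sup_range => y; apply: lee_real_addl.
by rewrite addeA; apply: (lee_sup_range _ y).
Qed.

Lemma form_of_density_linear f : linear_form (form_of_density f).
Proof.
have max0 : quasi_max_bounds (form_of_density f) 0.
  by split => // phi psi _ _; rewrite add0e; exact: form_of_density_max.
split; last exact: ereal_inf_lbound.
split; [|exact: form_of_density_homogeneous|by exists 0].
by move=> phi psi _ _; exact: form_of_density_mono.
Qed.

Lemma form_of_density_continuous f : continuous_form (form_of_density f).
Proof.
move=> phi_ phi Cphi_ Cphi mphi phi_cvg.
have mphi' y : {homo phi_ ^~ y : m n / (m <= n)%N >-> m <= n}.
  exact: homo_leq (fun x => lexx x) (fun x y z => @le_trans _ _ x y z)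
    (fun k => mphi k y).
have phi_sup y : ereal_sup (range (phi_ ^~ y)) = phi y.
  have /cvg_lim <- // := phi_cvg y.
  by apply/esym/cvg_lim => //; exact: ereal_nondecreasing_cvgn.
have mform : {homo (fun k => form_of_density f (phi_ k)) : m n /
    (m <= n)%N >-> m <= n}.
  by move=> m n mn; apply: form_of_density_mono => y; exact: mphi'.
have := ereal_nondecreasing_cvgn mform.
suff -> : ereal_sup (range (fun k => form_of_density f (phi_ k))) =
  form_of_density f phi by [].
apply/eqP; rewrite eq_le; apply/andP; split.
  apply: ge_sup_range => k; apply: form_of_density_mono => y.
  by rewrite -phi_sup; exact: lee_sup_range.
apply: ge_sup_range => y; apply: lee_real_below => c.
move=> /gte_add_split[a [ay ca]].
have : a%:E < ereal_sup (range (phi_ ^~ y)) by rewrite phi_sup.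
move=> /ereal_sup_gt[_ [k _ <-] ak].
apply: le_trans (lee_sup_range _ k).
apply: le_trans (lee_sup_range _ y).
have -> : c = (a + (c - a))%R by rewrite addrC subrK.
by rewrite EFinD; apply: leeD; exact: ltW.
Qed.

Lemma form_of_density_lt_pinfty f :
  form_of_density f (maxplus_indic [set: Y]) < +oo ->
  forall phi, Cb phi -> form_of_density f phi < +oo.
Proof.
move=> h phi [_ [M phiM]].
have : form_of_density f phi <=
    M%:E + form_of_density f (maxplus_indic [set: Y]).
  apply: ge_sup_range => y; apply: leeD (phiM y) _.
  by apply: le_trans (lee_sup_range _ y); rewrite indic_in // add0e.
by move=> /le_lt_trans -> //; exact: lte_add_pinfty (ltry _) h.
Qed.

Lemma form_of_density_indic f A :
  form_of_density f (maxplus_indic A) = ereal_sup [set - f y | y in A].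
Proof.
apply/eqP; rewrite eq_le; apply/andP; split.
  apply: ge_sup_range => y; have [Ay|nAy] := pselect (A y).
    by rewrite indic_in // add0e; apply: ereal_sup_ubound; exists y.
  by rewrite indic_out // leNye.
apply: ge_ereal_sup => _ [y Ay <-]; apply: le_trans (lee_sup_range _ y).
by rewrite indic_in // add0e.
Qed.

(** The extension of a form with lower semicontinuous density [f] is computed by
    [f] on sets: with [s] real and above [sup_A (- f)], the function
    [mine (f + s) 0] is lower semicontinuous, dominates the indicator of [A],
    and has value at most [s]. *)
Lemma on_set_density f A : Cb_approximable (R := R) (Y := Y) ->
  lower_semicontinuous f ->
  on_set (form_of_density f) A = ereal_sup [set - f y | y in A].
Proof.
move=> apx lf; apply/eqP; rewrite eq_le; apply/andP; split; last first.
  apply: ge_ereal_sup => _ [y Ay <-].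
  apply: le_ereal_inf_tmp => _ [psi [lpsi Apsi] <-].
  have [psi_ [Cpsi _ psi_le psi_cvg]] := apx _ lpsi.
  apply: lee_real_below => c cy.
  have : c%:E < psi y - f y.
    apply: lt_le_trans cy _; rewrite -{1}[- f y]add0e; apply: leeD2r.
    by apply: le_trans (Apsi y); rewrite indic_in.
  move=> /gte_add_split[a [/psi_cvg[k ak] ca]].
  apply: (@le_trans _ _ (form_of_density f (psi_ k))).
    apply: le_trans (lee_sup_range _ y).
    have -> : c = (a + (c - a))%R by rewrite addrC subrK.
    by rewrite EFinD; apply: leeD; exact: ltW.
  by apply: ereal_sup_ubound; exists (psi_ k).
apply: lee_real_above => s sA.
pose psi y := mine (s%:E + f y) 0.
have lpsi : lsc_Rmax psi.
  split=> [y a|y]; last by rewrite gt_min ltry orbT.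
  rewrite lt_min => /andP[ay a0].
  have [V yV Va] : exists2 V, nbhs y V & forall z, V z -> (a - s)%:E < f z.
    apply: lf; case: (f y) ay => [r| |] //=; rewrite ?ltry //.
    by rewrite -EFinD !lte_fin; lra.
  exists V => // z /Va az; rewrite lt_min a0 andbT.
  case: (f z) az => [r| |] //=; rewrite ?ltry //.
  by rewrite -EFinD !lte_fin; lra.
apply: (@le_trans _ _ (extend_lsc (form_of_density f) psi)).
  apply: ereal_inf_lbound; exists psi => //; split => //.
  apply: indic_le => y Ay; rewrite le_min lexx andbT.
  have : - f y <= s%:E.
    by apply: le_trans (ltW sA); apply: ereal_sup_ubound; exists y.
  case: (f y) => [r| |] //=; rewrite ?leye_eq ?leey //.
  by rewrite -EFinD !lee_fin; lra.
apply: ge_ereal_sup => _ [chi [Cchi chile] <-]; apply: ge_sup_range => y.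
apply: (@le_trans _ _ (psi y - f y)); first exact: leeD2r.
rewrite /psi; case: (f y) => [r| |] /=; rewrite ?leNye //; last first.
  by rewrite min_l ?leNye.
apply: (@le_trans _ _ (s%:E + r%:E - r%:E)).
  by apply: leeD2r; rewrite ge_min lexx.
by rewrite -!EFinD addrK.
Qed.

End densities.

(** * Conjugacies *)

Section conjugacies.
Context {R : realType} {X Y : topologicalType}.
Variables (b : X -> Y -> \bar R) (g : X -> \bar R).
Implicit Types (f : Y -> \bar R).
Local Notation Bg := (dual_conjugate b g).

Lemma dual_conjugate_le x y : b x y - g x <= Bg y.
Proof. exact: (lee_sup_range (fun x => b x y - g x)). Qed.

Lemma sub_dual_conjugate_le x y : b x y - Bg y <= g x.
Proof. exact/lee_subl_swap/dual_conjugate_le. Qed.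

Lemma dual_conjugate_le_of_conjugate f : (forall x, conjugate b f x <= g x) ->
  forall y, Bg y <= f y.
Proof.
move=> h y; apply: ge_sup_range => x; apply: lee_subl_swap.
by apply: le_trans (h x); exact: lee_sup_range.
Qed.

Lemma dual_conjugate_lsc : (forall x, lower_semicontinuous (b x)) ->
  lower_semicontinuous Bg.
Proof.
move=> lb y a /lte_real_between[c [ac /ereal_sup_gt[_ [x _ <-]]]].
move=> /gte_add_split[r [/lb[V yV Vr] cg]]; exists V => // z /Vr rz.
apply: lt_le_trans ac _; apply: le_trans (dual_conjugate_le x z).
have -> : c = (r + (c - r))%R by rewrite addrC subrK.
by rewrite EFinD; apply: leeD; exact: ltW.
Qed.

(** Equality of [f] and [dual_conjugate b g] at the maximizer comes for free:
    they are squeezed between [b x y - g x] and [f y], which coincide there. *)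
Lemma subdiff_attained f x : g x \is a fin_num ->
  (forall y, Bg y <= f y) -> conjugate b f x = g x ->
  usc (fun y => b x y - f y) ->
  (forall r : R, precompact [set y | r%:E <= b x y - Bg y]) ->
  exists y, [/\ dual_subdiff b g x y, f y = Bg y & Bg y \is a fin_num].
Proof.
move=> gx_fin Bgf fg uh pre; have gxE := fineK gx_fin; set s := fine (g x) in gxE.
have [y ys] : exists y, b x y - f y = s%:E.
  apply: usc_attains_sup => //.
  - by move=> y; rewrite gxE -fg; exact: lee_sup_range.
  - move=> r; rewrite -lte_fin gxE -fg => /ereal_sup_gt[_ [y _ <-] ry].
    by exists y.
  - move=> r; apply: precompact_subset (pre r) => y /= ry.
    by apply: le_trans ry _; apply: leeD2l; rewrite leeN2.
have := dual_conjugate_le x y; have := Bgf y; have := ys.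
rewrite -gxE.
case bE: (b x y) => [u| |] //; case fE: (f y) => [v| |] //.
rewrite -EFinB => -[uv].
move=> Bgv vBg.
have Bgy : Bg y = v%:E.
  apply/eqP; rewrite eq_le Bgv /=; apply: le_trans vBg.
  by rewrite -EFinB lee_fin -uv; lra.
exists y; rewrite Bgy; split => //; split; first by rewrite bE.
move=> x'; apply: le_trans (dual_conjugate_le x' y) _.
by rewrite Bgy bE -gxE -EFinB lee_fin -uv; lra.
Qed.

Lemma idom_nbhs_bounded x : idom g x ->
  exists2 M : R, nbhs x [set z | g z <= M%:E] & g x \is a fin_num.
Proof.
move=> [gx /lte_real_between[M [gM _]]]; exists M => //.
by apply: filterS (limf_esup_lt gM) => z /ltW.
Qed.

(** Under coercivity: on a neighbourhood of [x] where [g <= M], each [b z] is at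
    most [M + dual_conjugate b g], so [r <= b x y - dual_conjugate b g y] forces
    the gap at [y] to be at most [M - r]. *)
Lemma precompact_superlevel : (forall x y, b x y < +oo) ->
  Fc b Bg \/ coercive b -> forall x, idom g x ->
  forall r : R, precompact [set y | r%:E <= b x y - Bg y].
Proof.
move=> b_oo [[_ h] x _ r|coer x /idom_nbhs_bounded[M xM gx] r]; first exact: h.
apply: precompact_subset (coer x _ xM (M - r)%R) => y /= ry.
have sup_le : ereal_sup [set b z y | z in [set z | g z <= M%:E]] <= M%:E + Bg y.
  apply: ge_ereal_sup => _ [z /= zM <-].
  have := le_trans (sub_dual_conjugate_le z y) zM.
  case: (b z y) (b_oo z y) => [u| |] // _; case: (Bg y) => [v| |] //=;
    rewrite ?leey ?leNye //.
  by rewrite -EFinB -EFinD !lee_fin; lra.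
apply: le_trans (leeD2r _ sup_le) _.
have := sub_dual_conjugate_le x y; move: ry.
case: (b x y) (b_oo x y) => [u| |] // _.
case: (Bg y) => [v| |] //=; last first.
  by rewrite leye_eq => _ /eqP gxoo; move: gx; rewrite gxoo.
by rewrite -?EFinB !lee_fin; lra.
Qed.

End conjugacies.

(** * Recovering the kernel functions from the rate function *)

Section recovery.
Context {R : realType} {X Y : topologicalType} {I : Type}.
Variables (b : X -> Y -> \bar R) (N : I -> (Y -> \bar R) -> \bar R).
Hypothesis N_mono : forall i, maxplus_monotone (N i).

Definition sup_functional (phi : Y -> \bar R) : \bar R :=
  ereal_sup (range (N ^~ phi)).

Lemma sup_functional_monotone : maxplus_monotone sup_functional.
Proof.
split=> [phi psi h|a phi]; apply: ge_sup_range => i.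
  by apply: le_trans (lee_sup_range _ i); have [mono _] := N_mono i; exact: mono.
apply: le_trans ((N_mono i).2 a phi) _; apply: leeD2l.
exact: (lee_sup_range (N ^~ phi)).
Qed.

Hypothesis N_max : forall i, max_stable (N i).
Hypothesis N_tight : forall i, tight (N i).
Hypothesis N_mass : forall i, N i (maxplus_indic [set: Y]) < +oo.

(** Tightness and finite mass hold for each [N i] but may fail for their
    supremum, so the bound passes through the rate function of [N i]. *)
Lemma sup_functional_upper_bound phi (M : R) : usc phi ->
  (forall y, phi y <= M%:E) ->
  sup_functional phi <= form_of_density (rate sup_functional) phi.
Proof.
move=> uphi phiM; apply: ge_sup_range => i.
apply: le_trans (rate_upper_bound (N_mono i) _ _ _ uphi phiM) _ => //.
apply: form_of_density_antitone; apply: rate_antitone => psi.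
exact: (lee_sup_range (N ^~ psi)).
Qed.

(** [b x] is unbounded, so the upper bound only applies where [b x <= M']. By
    upper coercivity, off that set [b x] lies below [b z - beta] for one of
    finitely many [z] near [x], where [g] is bounded by [M]; the contribution of
    such a region is at most [M - beta], and [beta] is arbitrary. *)
Lemma sup_functional_le_conjugate x : upper_coercive b -> usc (b x) ->
  idom (fun z => sup_functional (b z)) x ->
  sup_functional (b x) <= conjugate b (rate sup_functional) x.
Proof.
move=> hupper ubx /idom_nbhs_bounded[M xM _].
have [W [/finite_seqP[s ->] WM hW]] := hupper x _ xM.
(* With [beta = M - c], a region where [b x <= b z - beta] contributes at most
   [M - beta = c]. *)
apply: lee_real_above => c xc; have [M' bM'] := hW (M - c)%R.
apply: ge_sup_range => i; have [mono shift] := N_mono i.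
pose J A := N i (cut A (b x)) <= c%:E.
pose A z := [set y | b x y <= (c - M)%:E + b z y].
have Jsub B C : B `<=` C -> J C -> J B.
  move=> BC; apply: le_trans; apply: mono; apply: cut_le => y By.
  by rewrite cut_in //; exact: BC.
have JU B C : J B -> J C -> J (B `|` C).
  move=> JB JC; apply: le_trans (N_max JB JC); apply: mono.
  apply: cut_le => y [By|Cy]; rewrite le_max.
    by rewrite (cut_in _ By) lexx.
  by rewrite (cut_in _ Cy) lexx orbT.
have Jlow : J [set y | b x y <= M'%:E].
  apply: (@le_trans _ _ (sup_functional (fun y => mine (b x y) M'%:E))).
    apply: le_trans (lee_sup_range _ i); apply: mono; apply: cut_le => y /= yM'.
    by rewrite le_min lexx yM'.
  apply: le_trans (@sup_functional_upper_bound _ M' _ _) _.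
  - move=> y a; rewrite gt_min => /orP[ya|M'a].
      by apply: filterS (ubx _ _ ya) => z za; rewrite gt_min za.
    by apply: filterE => z; rewrite gt_min M'a orbT.
  - by move=> y; rewrite ge_min lexx orbT.
  - apply: le_trans (ltW xc); apply: form_of_density_mono => y.
    by rewrite ge_min lexx.
have JA z : z \in s -> J (A z).
  move=> zs; apply: (@le_trans _ _ ((c - M)%:E + N i (b z))).
    by apply: le_trans (shift _ _); apply: mono; exact: cut_le.
  rewrite -[in leRHS](subrK M c) [leRHS]EFinD; apply: leeD2l; apply: le_trans (WM z zs).
  exact: (lee_sup_range (N ^~ (b z))).
have J0 : J set0 by apply: Jsub Jlow; exact: sub0set.
have Jhigh : J [set y | exists2 z, z \in s & A z y].
  elim: (s) JA => [|z t IH] JA; first by apply: Jsub J0 => y [].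
  have Jt : J [set y | exists2 z, z \in t & A z y].
    by apply: IH => z' z't; apply: JA; rewrite inE z't orbT.
  have Jz : J (A z) by apply: JA; rewrite inE eqxx.
  apply: Jsub (JU _ _ Jz Jt) => y [z']; rewrite inE => /orP[/eqP ->|z't] Ay.
    by left.
  by right; exists z'.
have cover : J ([set y | b x y <= M'%:E] `|`
    [set y | exists2 z, z \in s & A z y]).
  exact: JU.
apply: le_trans cover; apply: mono => y; rewrite cut_in //.
have [yM'|yM'] := leP (b x y) M'%:E; [by left | right].
have : (M - c)%:E < kernel_gap b x [set` s] y.
  by rewrite ltNge; apply/negP => /bM'; rewrite leNgt yM'.
move=> /gte_add_split[r [/ereal_sup_gt[_ [z zs <-] rz] rc]].
exists z => //; rewrite /A /=.
case: (b x y) (b z y) rz rc => [u| |] [v| |] //=; rewrite ?leey ?leNye //.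
by rewrite -?EFinB !lte_fin lee_fin; lra.
Qed.

End recovery.

(** * Essential elements of the covering *)

Section essential.
Context {R : realType} {X Y : topologicalType}.
Variables (b : X -> Y -> \bar R) (g : X -> \bar R) (f : Y -> \bar R).
Local Notation Bg := (dual_conjugate b g).
Let Phi (y : set_type (ldom Bg)) := dual_subdiff_inv b g (set_val y).
Hypothesis attained : forall x, idom g x ->
  exists y, [/\ dual_subdiff b g x y, f y = Bg y & Bg y \is a fin_num].

(** The elements where [f] and [dual_conjugate b g] agree cover [idom g] by
    themselves, so no set [U] whose complement fails to cover can avoid them. For
    [U] a singleton this concerns algebraic essentiality, for [U] open
    topological essentiality. *)
Lemma essential_contact (U : set (set_type (ldom Bg))) :
  ~ (idom g `<=` \bigcup_(z in ~` U) Phi z) ->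
  exists2 z, U z & f (set_val z) = Bg (set_val z) /\
                   Bg (set_val z) \is a fin_num.
Proof.
move=> ess; apply: contrapT => noU; apply: ess => x gx.
have [y [xy fy Bgy]] := attained gx.
have yl : y \in ldom Bg.
  by rewrite inE /ldom /=; move: Bgy; rewrite fin_numElt => /andP[].
exists (SigSub yl) => //= Uy; apply: noU; exists (SigSub yl) => //.
Qed.

Lemma subdiff_covering : covering Phi (idom g).
Proof.
move=> x gx; have [y [xy fy Bgy]] := attained gx.
have yl : y \in ldom Bg.
  by rewrite inE /ldom /=; move: Bgy; rewrite fin_numElt => /andP[].
by exists (SigSub yl).
Qed.

Lemma algebraically_essential_eq z :
  algebraically_essential Phi (idom g) z -> f (set_val z) = Bg (set_val z).
Proof. by move=> /essential_contact[_ -> []]. Qed.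

(** The points where [f = Bg] are dense in the interior of the set of
    topologically essential elements. If [Bg y < a < f y], quasi-continuity gives
    a nonempty relatively open set arbitrarily close to [y] on which [Bg < a],
    while [f > a] near [y] by semicontinuity, and such a point cannot lie there. *)
Lemma topologically_essential_eq y :
  lower_semicontinuous f -> (forall z, Bg z <= f z) ->
  quasi_continuous_on_domain Bg ->
  relative_interior (dom Bg)
    (set_val @` topologically_essential Phi (idom g)) y ->
  f y = Bg y.
Proof.
move=> lf Bgf qc [s sZ <-]; apply/eqP; rewrite eq_le Bgf andbT.
apply: lee_real_above => a sa; rewrite leNgt; apply/negP => /lf[V sV Va].
have oG : open [set u : \bar R | u < a%:E] by exact: open_ereal_lt_ereal.
have clo := qc _ oG s sa.
have nV : nbhs s (set_val @^-1` V : set (set_type (dom Bg))).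
  exact: (@initial_continuous _ Y (set_val : set_type (dom Bg) -> Y) s).
have [o [oint [oV oZ]]] := clo _ (filterI (nbhs_interior nV) (nbhs_interior sZ)).
(* The neighbourhood of [o] is taken in [dom Bg], but essentiality of [t] is
   about [ldom Bg]: an open set of [Y] inducing both is needed. *)
have : nbhs o (interior ((fun s : set_type (dom Bg) => Bg (set_val s)) @^-1`
    [set u | u < a%:E]) `&` (set_val @^-1` V)).
  apply: filterI; last exact: oV.
  by apply: open_nbhs_nbhs; split => //; exact: open_interior.
rewrite nbhsE => -[_ [[O oO <-] Oo] OVG].
have [t /= tess to] := nbhs_singleton oZ.
have oU : open (set_val @^-1` O : set (set_type (ldom Bg))) by exists O.
have Ut : (set_val @^-1` O : set (set_type (ldom Bg))) t by rewrite /= to.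
have [z /= zO [fz Bgz]] := essential_contact (tess _ oU Ut).
have zd : set_val z \in dom Bg by rewrite inE.
have [/interior_subset /= za zV] := OVG (SigSub zd) zO.
by have := Va _ zV; rewrite fz ltNge => /negP; apply; exact: ltW.
Qed.

End essential.

Theorem theorem5p5 (R : realType) (X Y : topologicalType)
    (b : X -> Y -> \bar R) (I : Type)
    (F_ : nat -> I -> (Y -> \bar R) -> \bar R) (g : X -> \bar R)
    (hX : hausdorff_space X) (hY : polish_space R Y)
    (hb : standing_kernel b)
    (hQL : forall n i, QL (F_ n i))
    (htight : forall i, asymptotically_tight (fun n => F_ n i))
    (hmass : forall i, limn_esup (fun n => on_set (F_ n i) [set: Y]) < +oo)
    (hrho : forall i, rho (F_ n i) @[n --> \oo] --> (0 : \bar R))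
    (hg : forall x, g x = sup_limsup (fun n i => extend (F_ n i) (b x)))
    (hdisc : discrete_space Y \/
       ((forall x, continuous (b x)) /\ forall y, -oo < dual_conjugate b g y))
    (hcoer : Fc b (dual_conjugate b g) \/ coercive b)
    (hupper : upper_coercive b)
    (hquasi : quasi_continuous_on_domain (dual_conjugate b g)) :
  let Bg := dual_conjugate b g in
  let Fbar := form_of_density Bg in
  let L (A : set Y) := sup_limsup (fun n i => on_set (F_ n i) A) in
  let Phi (y : set_type (ldom Bg)) := dual_subdiff_inv b g (set_val y) in
  let Za := set_val @` algebraically_essential Phi (idom g) in
  let Zt := set_val @` topologically_essential Phi (idom g) in
  let Z := Za `|` relative_interior (dom Bg) Zt in
  exists (F : (Y -> \bar R) -> \bar R) (f : Y -> \bar R),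
    [/\ [/\ linear_form F /\ continuous_form F,
            (* closed [C = Y] below forces [L [set: Y] < +oo] if [calL F] *)
            L [set: Y] < +oo -> calL F,
            forall G, open G -> on_set F G <= L G &
            forall C, closed C -> L C <= on_set F C],
        lower_semicontinuous f /\ density F f,
        [/\ forall x, conjugate b f x <= g x,
            forall x, (idom g `|` g @^-1` [set -oo]) x -> conjugate b f x = g x &
            covering Phi (idom g)],
        (forall y, Bg y <= f y) /\
          (forall C, closed C -> L C <= on_set Fbar C) &
        (forall y, Z y -> f y = Bg y) /\
          (forall G, open G -> on_set Fbar (G `&` Z) <= L G)].
Proof.
move=> Bg Fbar L Phi Za Zt Z.
have apx := polish_Cb_approximable hY.
have [b_oo lb _ _] := hb.
pose N i phi := limn_esup (fun n => extend (F_ n i) phi).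
have N_mono i : maxplus_monotone (N i) by apply: limsup_monotone => n.
have N_max i : max_stable (N i) by apply: limsup_max_stable => // n.
have N_tight i : tight (N i) by exact: limsup_tight.
have gE x : g x = sup_functional N (b x) by exact: hg.
have sup_mono := sup_functional_monotone N_mono.
set f := rate (sup_functional N).
have lf : lower_semicontinuous f by exact: rate_lsc.
have lBg : lower_semicontinuous Bg by exact: dual_conjugate_lsc.
have Bf_le x : conjugate b f x <= g x.
  by rewrite gE; apply: ge_sup_range => y; exact: rate_lower_bound.
have Bgf : forall y, Bg y <= f y by exact: dual_conjugate_le_of_conjugate.
have ub x : usc (b x).
  by case: hdisc => [dY|[cb _]]; [exact: discrete_usc | exact: continuous_usc].
have ubf x : usc (fun y => b x y - f y).
  case: hdisc => [dY|[cb Bg_oo]]; first exact: discrete_usc.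
  by apply: usc_sub => // y; apply: lt_le_trans (Bg_oo y) (Bgf y).
have Bf_idom x : idom g x -> conjugate b f x = g x.
  move=> gx; apply/eqP; rewrite eq_le Bf_le gE /=.
  apply: sup_functional_le_conjugate => //.
  by have <- : g = (fun z => sup_functional N (b z)) by exact/funext.
have attained x : idom g x ->
    exists y, [/\ dual_subdiff b g x y, f y = Bg y & Bg y \is a fin_num].
  move=> gx; apply: subdiff_attained => //; first by case: gx.
    exact: Bf_idom.
  exact: precompact_superlevel.
have L_closed C : closed C -> L C <= on_set (form_of_density f) C.
  move=> cC; rewrite on_set_density // -form_of_density_indic.
  apply: (@sup_functional_upper_bound _ _ _ _ _ _ _ _ _ 0%R) => //.
    exact: indic_usc.
  by apply: indic_le.
have L_open G : open G -> on_set (form_of_density f) G <= L G.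
  move=> oG; rewrite on_set_density //; apply: ge_ereal_sup => _ [y Gy <-].
  rewrite /f /rate oppeK; apply: ereal_inf_lbound.
  by exists G.
have f_eq y : Z y -> f y = Bg y.
  move=> [[z zess <-]|]; first exact: algebraically_essential_eq zess.
  exact: topologically_essential_eq.
exists (form_of_density f), f; split.
- split => //.
  + by split; [exact: form_of_density_linear | exact: form_of_density_continuous].
  + move=> LY; have [lin rho0] := form_of_density_linear f.
    split => //; split => //; first exact: form_of_density_continuous.
    apply: form_of_density_lt_pinfty; apply: le_lt_trans LY.
    by rewrite form_of_density_indic -on_set_density //; apply: L_open; exact: openT.
- by split.
- split => //; last exact: (subdiff_covering attained).
  move=> x [|/= gx]; first exact: Bf_idom.
  by apply/eqP; rewrite gx -leeNy_eq -gx.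
- split => // C cC; apply: le_trans (L_closed C cC) _.
  rewrite !on_set_density //; apply: ge_ereal_sup => _ [y Cy <-].
  apply: (@le_trans _ _ (- Bg y)); first by rewrite leeN2.
  by apply: ereal_sup_ubound; exists y.
- split => // G oG; apply: le_trans (L_open G oG).
  rewrite !on_set_density //; apply: ge_ereal_sup => _ [y [Gy Zy] <-].
  by apply: ereal_sup_ubound; exists y => //; rewrite f_eq.
Qed.
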